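(* Fix $k\ge1$, $\beta\in\mathbb{R}^k$ and $\sigma^2>0$. For each integer $n>k$ let $X_n$ be a non-random real $n\times k$ matrix of rank $k$ and $Y_n=X_n\beta+\varepsilon_n$, where the random vector $\varepsilon_n\in\mathbb{R}^n$ is normally distributed with $E(\varepsilon_n)=0$ and $\operatorname{cov}(\varepsilon_n)=\sigma^2I_n$. Let $b_n$ be the OLS-estimator and let $$\tilde b_{o,n}=b_n-\operatorname{sign}(z_{1n}^T\delta_n)\,\sqrt{\frac{\lambda_{1n}}{\pi}}\;\frac{\Gamma((n-k+1)/2)}{\Gamma((n-k+2)/2)}\,\sqrt{e_n^Te_n}\;z_{1n}$$ be the optimal quasi-estimator, where $\lambda_{1n}$ is the maximum eigenvalue of $(X_n^TX_n)^{-1}$ and $z_{1n}$ ($z_{1n}^Tz_{1n}=1$) is a normalized eigenvector corresponding to it. If the OLS-estimator is consistent in the mean-square sense, i.e. $E((b_n-\beta)^T(b_n-\beta))\to0$ as $n\to\infty$, then the optimal quasi-estimator is also consistent in the same sense, i.e. $E((\tilde b_{o,n}-\beta)^T(\tilde b_{o,n}-\beta))\to0$ as $n\to\infty$.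
   Context: For each $n$: the OLS-estimator is $b_n=(X_n^TX_n)^{-1}X_n^TY_n$; its random error is $\delta_n=b_n-\beta=(X_n^TX_n)^{-1}X_n^T\varepsilon_n$; the residual vector is $e_n=Y_n-X_nb_n$. The sign function is $\operatorname{sign}(x)=1$ if $x\ge 0$ and $\operatorname{sign}(x)=-1$ if $x<0$. All square roots are nonnegative. $\Gamma$ is the gamma-function, $I_n$ the $n\times n$ identity matrix and $\operatorname{cov}$ denotes the variance-covariance matrix. Mean-square consistency of the OLS-estimator is equivalent to $\lim_{n\to\infty}(X_n^TX_n)^{-1}=0$. *)

(* Defs.v *)
(* MathComp / MathComp-Analysis world. *)
From HB Require Import structures.
From mathcomp Require Import all_boot all_order all_algebra.
From mathcomp Require Import all_classical all_reals all_analysis.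

Set Implicit Arguments.
Unset Strict Implicit.
Unset Printing Implicit Defensive.

Import Order.TTheory GRing.Theory Num.Theory.
Import numFieldNormedType.Exports.

Local Open Scope classical_set_scope.
Local Open Scope ring_scope.

Definition Gamma (R : realType) (x : R) : R :=
  \int[lebesgue_measure]_(t in `]0, +oo[) ((t `^ (x - 1)) * expR (- t)).

(* Unlike [Num.sg], the value at 0 is 1. *)
Definition sign (R : realType) (x : R) : R := if 0 <= x then 1 else -1.

Definition dotcv (R : realType) (n : nat) (u v : 'cV[R]_n) : R :=
  (u^T *m v) ord0 ord0.

(* [eigenvalue] is about row eigenvectors, but a square matrix and its
   transpose have the same eigenvalues. *)
Definition is_max_eigenvalue (R : realType) (k : nat) (A : 'M[R]_k) (l : R) :
    Prop :=
  eigenvalue A l /\ forall m : R, eigenvalue A m -> m <= l.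

Section random_vectors.
Context d (T : measurableType d) (R : realType) (P : probability T R).

Definition rvec (n : nat) (X : 'I_n -> {RV P >-> R}) (w : T) : 'cV[R]_n :=
  \col_i X i w.

(* Law of N(m, s^2). The case s = 0 is separated because [normal_prob m 0] is,
   by convention, the uniform probability on [0, 1] and not the point mass.
   Laws are compared on measurable sets only. *)
Definition normal_law (f : T -> R) (m s : R) : Prop :=
  forall A : set R, measurable A ->
    P (f @^-1` A) = if s == 0 then \d_m A else normal_prob m s A.

(* A random vector is normally distributed when each linear combination of its
   components has a (possibly degenerate) normal law. *)
Definition normal_rvec (n : nat) (X : 'I_n -> {RV P >-> R}) : Prop :=
  forall a : 'cV[R]_n, exists m s : R,
    normal_law (fun w => dotcv a (rvec X w)) m s.

Definition has_mean (n : nat) (X : 'I_n -> {RV P >-> R}) (mu : 'cV[R]_n) :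
    Prop :=
  forall i, 'E_P[X i]%E = (mu i ord0)%:E.

Definition has_cov (n : nat) (X : 'I_n -> {RV P >-> R}) (S : 'M[R]_n) : Prop :=
  forall i j, covariance P (X i) (X j) = (S i j)%:E.

Definition mean_square_error (k : nat) (b : T -> 'cV[R]_k) (beta : 'cV[R]_k) :
    \bar R :=
  'E_P[fun w => dotcv (b w - beta) (b w - beta)]%E.

End random_vectors.

Section estimators.
Context (R : realType) (n k : nat).
Implicit Types (X : 'M[R]_(n, k)) (Y : 'cV[R]_n) (beta z : 'cV[R]_k) (l : R).

Definition ols X Y : 'cV[R]_k := invmx (X^T *m X) *m X^T *m Y.

Definition ols_error X Y beta : 'cV[R]_k := ols X Y - beta.

Definition residual X Y : 'cV[R]_n := Y - X *m ols X Y.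

Definition optimal_quasi_estimator X Y beta l z : 'cV[R]_k :=
  ols X Y -
  (sign (dotcv z (ols_error X Y beta))
   * Num.sqrt (l / pi)
   * (Gamma ((n%:R - k%:R + 1) / 2) / Gamma ((n%:R - k%:R + 2) / 2))
   * Num.sqrt (dotcv (residual X Y) (residual X Y))) *: z.

End estimators.

(* Main.v *)
Require Import Defs.
From HB Require Import structures.
From mathcomp Require Import all_boot all_order all_algebra.
From mathcomp Require Import all_classical all_reals all_analysis.
From mathcomp Require Import measurable_realfun ring lra.

Set Implicit Arguments.
Unset Strict Implicit.
Unset Printing Implicit Defensive.

Import Order.TTheory GRing.Theory Num.Theory.
Import numFieldNormedType.Exports.

Local Open Scope classical_set_scope.
Local Open Scope ring_scope.

(** Let delta be the error of the OLS-estimator b and let s be the variance of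
    the noise. The quasi-estimator has the error delta - c sqrt(e^T e) z up to
    a sign in front of z, where c = sqrt(l / pi) times a quotient of two values
    of Gamma, l is the eigenvalue of the unit vector z and e is the residual.
    As |u - v|^2 <= 2 |u|^2 + 2 |v|^2 and e is an orthogonal projection of the
    noise (residual_le), its mean square is at most
      2 E |delta|^2 + 2 c^2 E |eps|^2 = 2 E |delta|^2 + 2 c^2 s n.
    It remains to bound c^2 s n by a multiple, independent of n, of
    E |delta|^2.

    - The quotient of Gamma values is at most sqrt(2 / (n - k))
      (Gamma_ratio_le). Since n <= (k + 1) (n - k), this makes c^2 n at most
      2 (k + 1) / pi times l (sqr_factor_le).
    - The component of delta along z is a^T eps with |a|^2 = l, so its second
      moment is s l, whence s l <= E |delta|^2 (mse_ols_ge).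

    Therefore the mean square error of the quasi-estimator is at most
    2 + 4 (k + 1) / pi times that of b (mse_quasi_le), and a squeeze concludes.

    The bound on the Gamma quotient combines the arithmetic-geometric mean
    inequality under the integral sign with a Gamma(a) <= Gamma(a + 1), which
    is half of the functional equation. *)

(** * The quotient of Gamma at a + 1/2 and a + 1 *)

Section gamma_function.
Context {R : realType}.
Implicit Types (a t u v : R) (D : set R).
Local Notation mu := (@lebesgue_measure R).

Definition gamma_integrand a t : R := t `^ (a - 1) * expR (- t).

(** Values in the extended reals and an arbitrary domain allow inequalities to
    be proved on compact intervals and passed to the limit, without a prior
    study of the convergence of the integral. *)
Definition gamma_integral a D : \bar R :=
  (\int[mu]_(t in D) (gamma_integrand a t)%:E)%E.

Lemma GammaE a : Gamma a = fine (gamma_integral a `]0, +oo[).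
Proof. by []. Qed.

Lemma gamma_integrand_ge0 a t : 0 <= gamma_integrand a t.
Proof. by rewrite mulr_ge0 ?powR_ge0 ?expR_ge0. Qed.

Lemma measurable_gamma_integrand a D :
  measurable_fun D (EFin \o gamma_integrand a).
Proof.
apply: measurable_funTS; apply/measurable_EFinP; apply: measurable_funM.
  apply: (@measurableT_comp _ _ _ _ _ _ (fun x => x `^ (a - 1))).
    exact: measurable_powR.
  exact: measurable_id.
by apply: measurableT_comp => //; exact: measurable_funB.
Qed.

Lemma gamma_integral_ge0 a D : (0 <= gamma_integral a D)%E.
Proof. by apply: integral_ge0 => t _; rewrite lee_fin gamma_integrand_ge0. Qed.

(** The boundary term of the integration by parts vanishes at infinity: with
    m = a + 1, the inequality t / m <= exp (t / m) raised to the power m reads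
    t^m <= m^m exp t. *)
Lemma powR_mul_expRN_le a t : 0 < a -> 0 < t ->
  t `^ a * expR (- t) <= (a + 1) `^ (a + 1) / t.
Proof.
move=> a0 t0; have a1 : 0 < a + 1 by rewrite addr_gt0.
rewrite ler_pdivlMr// expRN mulrAC ler_pdivrMr ?expR_gt0//.
have -> : t `^ a * t = t `^ (a + 1).
  by rewrite powRD ?powRr1 ?ltW// gt_eqF.
rewrite -[X in _ <= _ * expR X](divfK (lt0r_neq0 a1)) expRM.
rewrite -powRM ?expR_ge0 ?(ltW a1)//.
rewrite ge0_ler_powR ?nnegrE ?mulr_ge0 ?expR_ge0 ?ltW//.
rewrite mulrC -ltr_pdivrMr//.
by rewrite (lt_trans _ (expR_gt1Dx _)) ?ltrDr// gt_eqF ?divr_gt0.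
Qed.

(** Integration by parts stays away from 0, where t^(a-1) may be unbounded. The
    boundary term at u has the favourable sign and is dropped. *)
Lemma gamma_integral_by_parts_le a u v : 0 < u -> u < v -> 0 < a ->
  (a%:E * gamma_integral a `[u, v] <=
   gamma_integral (a + 1) `]0%R, +oo[ + (v `^ a * expR (- v))%:E)%E.
Proof.
move=> u0 uv a0.
have v0 := lt_trans u0 uv.
have D_powR t : 0 < t ->
    is_derive t (1 : R^o) (fun x : R => x `^ a) (a * t `^ (a - 1)).
  exact: is_derive1_powR.
have D_expR t : is_derive t (1 : R^o) (fun x : R => - expR (- x)) (expR (- t)).
  have := is_deriveN (is_derive1_comp (is_derive_expR (- t))
    (is_deriveN (is_derive_id t (1 : R)))).
  by rewrite mulrN1 opprK.
have C_powR b t : 0 < t -> {for t, continuous (fun x : R => x `^ b)}.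
  move=> t0; apply: differentiable_continuous; apply/derivable1_diffP.
  by apply: derivable_powR; rewrite in_itv/= t0.
have C_expR : continuous (fun t : R => expR (- t)).
  move=> t; apply: continuous_comp; first exact: continuousN.
  exact: continuous_expR.
have itv_gt0 t : t \in `[u, v] -> 0 < t.
  by rewrite in_itv/= => /andP[/(lt_le_trans u0)].
have cvg_within (f : R -> R) (w : R) : {for w, continuous f} ->
    f @ w^'+ --> f w /\ f @ w^'- --> f w.
  by move=> cf; split; [exact: cvg_at_right_filter|exact: cvg_at_left_filter].
have within_cont (f : R -> R) : (forall t, 0 < t -> {for t, continuous f}) ->
    {within `[u, v], continuous f}.
  move=> cf; apply: continuous_in_subspaceT => t.
  by rewrite inE/= => /itv_gt0/cf.
have := @integration_by_parts R (fun x : R => x `^ a)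
  (fun x : R => - expR (- x)) (fun t => a * t `^ (a - 1))
  (fun t => expR (- t)) u v uv.
rewrite (_ : (\int[mu]_(x in `[u, v]) (a * x `^ (a - 1) * - expR (- x))%:E)%E
   = (- (a%:E * gamma_integral a `[u, v]))%E); last first.
  rewrite -ge0_integralZl_EFin ?ltW//; last 2 first.
  - by move=> t _; rewrite lee_fin gamma_integrand_ge0.
  - exact: measurable_gamma_integrand.
  rewrite -integral_ge0N => [|t _]; last first.
    by rewrite mule_ge0 ?lee_fin ?gamma_integrand_ge0 ?ltW.
  apply: eq_integral => t _.
  by rewrite /gamma_integrand -EFinM -EFinN; congr EFin; ring.
rewrite oppeK => parts.
have {}parts : (gamma_integral (a + 1) `[u, v] =
    (v `^ a * - expR (- v) - u `^ a * - expR (- u))%:E +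
    a%:E * gamma_integral a `[u, v])%E.
  rewrite -parts.
  - by apply: eq_integral => t _; rewrite /gamma_integrand addrK.
  - apply: within_cont => t t0; apply: continuousM; first exact: cst_continuous.
    exact: C_powR.
  - have [? _] := cvg_within _ _ (C_powR a _ u0).
    have [_ ?] := cvg_within _ _ (C_powR a _ v0).
    split => // t /subset_itv_oo_cc/itv_gt0/D_powR D; exact: ex_derive.
  - move=> t /subset_itv_oo_cc/itv_gt0/D_powR D.
    by rewrite derive1E; exact: derive_val.
  - by apply: within_cont => t _; exact: C_expR.
  - have CN t : {for t, continuous (fun x : R => - expR (- x))}.
      exact: (continuousN (C_expR t)).
    have [? _] := cvg_within _ _ (CN u); have [_ ?] := cvg_within _ _ (CN v).
    by split => // t _; exact: ex_derive.
  - by move=> t _; rewrite derive1E; exact: derive_val.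
apply: (@le_trans _ _
  (gamma_integral (a + 1) `[u, v] + (v `^ a * expR (- v))%:E)%E).
  rewrite parts addeAC -EFinD leeDr// lee_fin.
  rewrite [leRHS](_ : _ = u `^ a * expR (- u)); last by ring.
  by rewrite mulr_ge0 ?powR_ge0 ?expR_ge0.
rewrite leeD2r//; apply: ge0_subset_integral => //.
- exact: measurable_gamma_integrand.
- by move=> t _; rewrite lee_fin gamma_integrand_ge0.
- by move=> t /= /itv_gt0; rewrite in_itv/= andbT.
Qed.

(** The previous lemma on the intervals [1/n, n], which exhaust ]0, +oo[, gives
    this one by monotone convergence. *)
Lemma gamma_integral_recurrence_le a : 0 < a ->
  (a%:E * gamma_integral a `]0%R, +oo[ <= gamma_integral (a + 1) `]0%R, +oo[)%E.
Proof.
move=> a0; pose F n : set R := `[n.+2%:R^-1, n.+2%:R]%classic.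
have inv_lt n : n.+2%:R^-1 < n.+2%:R :> R.
  by rewrite (@lt_trans _ _ 1) ?invf_lt1 ?ltr1n.
have cvgF : gamma_integral a (F n) @[n --> \oo] -->
    gamma_integral a `]0%R, +oo[.
  rewrite [X in _ --> gamma_integral a X](_ : _ = \bigcup_n F n); last first.
    apply/seteqP; split=> t; rewrite /F /=.
      rewrite in_itv/= andbT => t0.
      have tV0 : 0 < t^-1 by rewrite invr_gt0.
      have := archi_boundP (ltW (addr_gt0 t0 tV0)); set m := Num.bound _ => tm.
      have mm : m%:R <= m.+2%:R :> R by rewrite ler_nat -addn2 leq_addr.
      exists m => //; rewrite /= in_itv/= -[X in _ <= X <= _]invrK.
      rewrite lef_pV2 ?posrE//; apply/andP; split; first lra.
      by rewrite invrK; lra.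
    move=> [n _]; rewrite /= !in_itv/= andbT => /andP[+ _].
    exact: lt_le_trans.
  apply: ge0_nondecreasing_set_cvg_integral => //.
  - apply/nondecreasing_seqP => n; rewrite subsetEset /F; apply: subset_itv.
      by rewrite bnd_simp lef_pV2 ?posrE// ler_nat.
    by rewrite bnd_simp ler_nat.
  - by move=> n; exact: measurable_itv.
  - by move=> n; exact: measurable_gamma_integrand.
  - by move=> n t _; rewrite lee_fin gamma_integrand_ge0.
have small n : ((n.+2%:R : R) `^ a * expR (- n.+2%:R) <=
    (a + 1) `^ (a + 1) * n.+1%:R^-1)%R.
  apply: (le_trans (powR_mul_expRN_le a0 _)) => //.
  by rewrite ler_wpM2l ?powR_ge0// lef_pV2 ?posrE// ler_nat.
have cvg_bound : (gamma_integral (a + 1) `]0%R, +oo[ +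
      ((a + 1) `^ (a + 1) * n.+1%:R^-1)%:E)%E @[n --> \oo] -->
    (gamma_integral (a + 1) `]0%R, +oo[ + 0)%E.
  apply: cvgeD; first exact: fin_num_adde_defl.
    exact: cvg_cst.
  apply: cvg_EFin; first exact: nearW.
  rewrite -(mulr0 ((a + 1) `^ (a + 1))); apply: cvgM; first exact: cvg_cst.
  exact: cvg_harmonic.
rewrite -[leRHS]adde0.
apply: (lee_cvg_to _ cvg_bound); first exact: (cvgeZl _ cvgF).
apply: nearW => n.
rewrite (le_trans (gamma_integral_by_parts_le _ (inv_lt n) a0)) ?invr_gt0//.
by rewrite leeD2l// lee_fin.
Qed.

(** With c = sqrt a, the inequality sqrt t <= c / 2 + t / (2 c) bounds the
    integral at a + 1/2 by a combination of those at a and a + 1; the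
    recurrence turns the one at a into one at a + 1. This value of c balances
    the two terms. *)
Lemma gamma_integral_half_le a : 0 < a ->
  (gamma_integral (a + 2^-1) `]0%R, +oo[ <=
   (Num.sqrt a)^-1%:E * gamma_integral (a + 1) `]0%R, +oo[)%E.
Proof.
move=> a0; set c := Num.sqrt a; have c0 : 0 < c by rewrite sqrtr_gt0.
have c2 : c ^+ 2 = a by rewrite sqr_sqrtr ?ltW.
set D : set R := `]0, +oo[%classic.
have c2_ge0 : 0 <= c / 2 by rewrite divr_ge0 ?ltW.
have cV_ge0 : 0 <= (2 * c)^-1 by rewrite invr_ge0 mulr_ge0 ?ltW.
have itvD : measurable D by exact: measurable_itv.
apply: (@le_trans _ _ ((c / 2)%:E * gamma_integral a D +
    ((2 * c)^-1)%:E * gamma_integral (a + 1) D)%E).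
  have mD b x : measurable_fun D (fun t => (x * gamma_integrand b t)%:E).
    apply/measurable_EFinP; apply: measurable_funM => //.
    by apply/measurable_EFinP; exact: measurable_gamma_integrand.
  have mulE b x : 0 <= x -> (x%:E * gamma_integral b D =
      \int[mu]_(t in D) (x * gamma_integrand b t)%:E)%E.
    move=> x0; rewrite -ge0_integralZl_EFin//.
    - by move=> t _; rewrite lee_fin gamma_integrand_ge0.
    - exact: measurable_gamma_integrand.
  rewrite !mulE// -ge0_integralD//; last 4 first.
  - by move=> t _; rewrite lee_fin mulr_ge0 ?gamma_integrand_ge0.
  - exact: mD.
  - by move=> t _; rewrite lee_fin mulr_ge0 ?gamma_integrand_ge0.
  - exact: mD.
  apply: ge0_le_integral => //.
  - by move=> t _; rewrite lee_fin gamma_integrand_ge0.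
  - exact: measurable_gamma_integrand.
  - by apply: emeasurable_funD; exact: mD.
  move=> t; rewrite /D/= in_itv/= andbT => t0.
  rewrite -EFinD lee_fin /gamma_integrand.
  set r := Num.sqrt t; have r0 : 0 < r by rewrite sqrtr_gt0.
  have r2 : r ^+ 2 = t by rewrite sqr_sqrtr ?ltW.
  have tn0 : t != 0 by rewrite gt_eqF.
  have -> : t `^ (a + 2^-1 - 1) = t `^ (a - 1) * r.
    by rewrite addrAC [LHS]powRD ?tn0 ?implybT// powR12_sqrt// ltW.
  have -> : t `^ (a + 1 - 1) = t `^ (a - 1) * r ^+ 2.
    by rewrite addrAC [LHS]powRD ?tn0 ?implybT// powRr1 ?ltW// r2.
  set p := t `^ (a - 1); set e := expR _.
  rewrite [leRHS](_ : _ = p * e * (c / 2 + (2 * c)^-1 * r ^+ 2)); last by ring.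
  rewrite mulrAC ler_wpM2l ?mulr_ge0 ?powR_ge0 ?expR_ge0//.
  rewrite -subr_ge0 [leRHS](_ : _ = (c - r) ^+ 2 / (2 * c)).
    by rewrite divr_ge0 ?sqr_ge0 ?mulr_ge0 ?ltW.
  by field; rewrite gt_eqF.
rewrite [X in (X + _)%E](_ : _ =
   (2 * c)^-1%:E * (a%:E * gamma_integral a D))%E; last first.
  rewrite muleA -EFinM; congr (_%:E * _)%E.
  by rewrite -c2; field; rewrite gt_eqF.
rewrite [in leRHS](_ : c^-1 = (2 * c)^-1 + (2 * c)^-1); last first.
  by field; rewrite gt_eqF.
rewrite EFinD ge0_muleDl ?lee_fin//.
rewrite leeD2r// lee_wpmul2l ?lee_fin//.
exact: gamma_integral_recurrence_le.
Qed.

Lemma Gamma_ge0 a : 0 <= Gamma a.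
Proof. by rewrite GammaE fine_ge0// gamma_integral_ge0. Qed.

Lemma Gamma_ratio_le a : 0 < a ->
  Gamma (a + 2^-1) / Gamma (a + 1) <= (Num.sqrt a)^-1.
Proof.
move=> a0; have := gamma_integral_half_le a0; rewrite !GammaE.
have := gamma_integral_ge0 (a + 2^-1) `]0, +oo[.
have := gamma_integral_ge0 (a + 1) `]0, +oo[.
have c0 : 0 <= (Num.sqrt a)^-1 by rewrite invr_ge0 sqrtr_ge0.
(* [fine] sends an infinite integral to 0; as x / 0 = 0 the quotient is then 0,
   so that infinite values satisfy the bound as well. *)
case: (gamma_integral (a + 1) _) => [g| |]//= g0; last by rewrite invr0 mulr0.
case: (gamma_integral (a + 2^-1) _) => [h| |]//=.
rewrite !lee_fin in g0 *; move=> h0 hg.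
have [->|gn0] := eqVneq g 0; first by rewrite invr0 mulr0.
by rewrite ler_pdivrMr// lt_neqAle eq_sym gn0.
Qed.

End gamma_function.

(** * Euclidean geometry of column vectors *)

Section euclidean.
Context {R : realType}.

Lemma dotcvE n (u v : 'cV[R]_n) : dotcv u v = \sum_i u i ord0 * v i ord0.
Proof. by rewrite /dotcv mxE; apply: eq_bigr => i _; rewrite mxE. Qed.

Lemma dotcvvE n (u : 'cV[R]_n) : dotcv u u = \sum_i u i ord0 ^+ 2.
Proof. by rewrite dotcvE. Qed.

Lemma dotcvv_ge0 n (u : 'cV[R]_n) : 0 <= dotcv u u.
Proof. by rewrite dotcvvE sumr_ge0// => i _; exact: sqr_ge0. Qed.

Lemma dotcvv_eq0 n (u : 'cV[R]_n) : dotcv u u = 0 -> u = 0.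
Proof.
rewrite dotcvvE => /psumr_eq0P u0; apply/matrixP => i j; rewrite (ord1 j) mxE.
apply/eqP; rewrite -(sqrf_eq0 (u i ord0)); apply/eqP/u0 => // ? _.
exact: sqr_ge0.
Qed.

Lemma dotcvC n (u v : 'cV[R]_n) : dotcv u v = dotcv v u.
Proof. by rewrite !dotcvE; apply: eq_bigr => i _; rewrite mulrC. Qed.

Lemma dotcvDl n (u v w : 'cV[R]_n) : dotcv (u + v) w = dotcv u w + dotcv v w.
Proof. by rewrite /dotcv linearD mulmxDl mxE. Qed.

Lemma dotcvZr n c (u v : 'cV[R]_n) : dotcv u (c *: v) = c * dotcv u v.
Proof. by rewrite /dotcv -scalemxAr mxE. Qed.

Lemma dotcvDr n (u v w : 'cV[R]_n) : dotcv u (v + w) = dotcv u v + dotcv u w.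
Proof. by rewrite /dotcv mulmxDr mxE. Qed.

Lemma dotcvZl n c (u v : 'cV[R]_n) : dotcv (c *: u) v = c * dotcv u v.
Proof. by rewrite dotcvC dotcvZr dotcvC. Qed.

Lemma dotcv_mull m n (A : 'M[R]_(m, n)) (u : 'cV[R]_n) (v : 'cV[R]_m) :
  dotcv (A *m u) v = dotcv u (A^T *m v).
Proof. by rewrite /dotcv trmx_mul mulmxA. Qed.

Lemma dotcv_sub_le n (u v : 'cV[R]_n) :
  dotcv (u - v) (u - v) <= 2 * dotcv u u + 2 * dotcv v v.
Proof.
rewrite !dotcvvE !mulr_sumr -big_split/= ler_sum// => i _; rewrite !mxE.
rewrite -subr_ge0; set x := u i ord0; set y := v i ord0.
by rewrite [leRHS](_ : _ = (x + y) ^+ 2) ?sqr_ge0//; ring.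
Qed.

(** The Cauchy-Schwarz inequality for a unit vector u: the difference of the
    two sides is the squared norm of v - (u^T v) u. *)
Lemma dotcv_sqr_le n (u v : 'cV[R]_n) : dotcv u u = 1 ->
  dotcv u v ^+ 2 <= dotcv v v.
Proof.
move=> u1; rewrite -subr_ge0; set c := dotcv u v.
suff -> : dotcv v v - c ^+ 2 = dotcv (v + - c *: u) (v + - c *: u).
  exact: dotcvv_ge0.
rewrite !dotcvDl !dotcvDr !dotcvZl !dotcvZr u1 [dotcv v u]dotcvC -/c; ring.
Qed.

End euclidean.

(** * Deterministic least squares *)

Section least_squares.
Context {R : realType} (n k : nat) (X : 'M[R]_(n, k)) (rankX : \rank X = k).
Let G := X^T *m X.
Let M := invmx G.

(** If X^T X annihilates a vector then so does X, because
    x^T X^T X x = |X x|^2; full column rank then forces the vector to be 0. *)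
Lemma gram_unitmx : G \in unitmx.
Proof.
rewrite -row_free_unit -kermx_eq0; apply/eqP/row_matrixP => i.
rewrite row0; set x := row i _.
have xG : x *m G = 0 by rewrite /x -row_mul mulmx_ker row0.
have Xx : X *m x^T = 0.
  apply: dotcvv_eq0; rewrite dotcv_mull mulmxA.
  have -> : X^T *m X *m x^T = 0.
    have -> : X^T *m X *m x^T = (x *m G)^T by rewrite /G !trmx_mul trmxK.
    by rewrite xG trmx0.
  by rewrite /dotcv mulmx0 mxE.
have XT : row_free X^T by rewrite /row_free mxrank_tr rankX.
apply: (row_free_inj XT); rewrite mul0mx.
by apply: trmx_inj; rewrite trmx_mul trmxK Xx trmx0.
Qed.

Lemma ols_error_model beta eps :
  ols_error X (X *m beta + eps) beta = M *m X^T *m eps.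
Proof.
rewrite /ols_error /ols mulmxDr !mulmxA -(mulmxA M X^T X) -/G.
by rewrite mulVmx ?gram_unitmx// mul1mx addrC addKr.
Qed.

Lemma residual_model beta eps :
  residual X (X *m beta + eps) = eps - X *m (M *m X^T *m eps).
Proof.
rewrite -(ols_error_model beta) /residual /ols_error mulmxBr.
by rewrite opprB addrCA addrA.
Qed.

(** The residual is the noise minus its orthogonal projection h on the column
    space of X, so this is the Pythagorean theorem. *)
Lemma residual_le beta eps :
  dotcv (residual X (X *m beta + eps)) (residual X (X *m beta + eps))
  <= dotcv eps eps.
Proof.
rewrite (residual_model beta); set h := X *m _.
have orth : dotcv h (eps - h) = 0.
  rewrite dotcv_mull mulmxBr /h !mulmxA -/G mulmxV ?gram_unitmx// mul1mx subrr.
  by rewrite /dotcv mulmx0 mxE.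
have pythagoras r : dotcv h r = 0 -> dotcv r r <= dotcv (r + h) (r + h).
  move=> hr; rewrite dotcvDl !dotcvDr [dotcv r h]dotcvC hr addr0 add0r.
  by rewrite lerDl dotcvv_ge0.
by rewrite -[in leRHS](subrK h eps) pythagoras.
Qed.

Lemma dotcv_ols_error z beta eps :
  dotcv z (ols_error X (X *m beta + eps) beta) = dotcv (X *m (M *m z)) eps.
Proof.
rewrite ols_error_model dotcv_mull dotcv_mull mulmxA.
by have -> : M^T = M by rewrite trmx_inv trmx_mul trmxK.
Qed.

(** This computes |a|^2 for the vector a such that z^T delta = a^T eps. *)
Lemma dotcv_gram_eigen z l : M *m z = l *: z -> dotcv z z = 1 ->
  dotcv (X *m (M *m z)) (X *m (M *m z)) = l.
Proof.
move=> Mz z1; rewrite dotcv_mull mulmxA [X^T *m _ *m _]mulmxA -/G.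
by rewrite mulmxV ?gram_unitmx// mul1mx dotcvC Mz dotcvZr z1 mulr1.
Qed.

End least_squares.

(** * Second moments of the noise *)

Section isotropic_noise.
Local Open Scope ereal_scope.
Context d (T : measurableType d) (R : realType) (P : probability T R).

(** The integral of a nonnegative function is a supremum over the simple
    functions below it, hence monotone even without measurability. This spares
    a proof that the error of the quasi-estimator, which involves a sign, is
    measurable. *)
Lemma ge0_le_expectation (f g : T -> R) : (forall w, 0 <= f w <= g w)%R ->
  'E_P[f] <= 'E_P[g].
Proof.
move=> fg; have f0 w : (0 <= f w)%R by have /andP[] := fg w.
have g0 w : (0 <= g w)%R by have /andP[] := fg w; exact: le_trans.
rewrite unlock !ge0_integralTE//.
apply: le_ereal_sup => _ [h /= hf <-]; exists h => //= w.
by rewrite (le_trans (hf w))// lee_fin; have /andP[] := fg w.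
Qed.

Lemma ge0_expectation_lincomb (f g : T -> R) (x y : R) :
  measurable_fun setT f -> measurable_fun setT g ->
  (forall w, 0 <= f w)%R -> (forall w, 0 <= g w)%R ->
  (0 <= x)%R -> (0 <= y)%R ->
  'E_P[fun w => (x * f w + y * g w)%R] = x%:E * 'E_P[f] + y%:E * 'E_P[g].
Proof.
move=> mf mg f0 g0 x0 y0; rewrite unlock.
under eq_integral do rewrite EFinD !EFinM.
have mE (h : T -> R) r : measurable_fun setT h ->
    measurable_fun setT (fun w => r%:E * (h w)%:E).
  by move=> mh; apply: measurable_funeM; exact/measurable_EFinP.
rewrite ge0_integralD//; last 4 first.
- by move=> w _; rewrite mule_ge0 ?lee_fin.
- exact: mE.
- by move=> w _; rewrite mule_ge0 ?lee_fin.
- exact: mE.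
by rewrite !ge0_integralZl_EFin//; try (by move=> w _; rewrite lee_fin);
  exact/measurable_EFinP.
Qed.

Variables (n : nat) (eps : 'I_n -> {RV P >-> R}) (s : R).
Hypothesis eps_mean : has_mean eps 0.
Hypothesis eps_cov : has_cov eps (s *: 1%:M).

Lemma expectation_noiseM i j :
  \int[P]_w (eps i w * eps j w)%:E = (s *+ (i == j))%:E.
Proof.
have := eps_cov i j; rewrite !mxE mulr_natr.
rewrite covariance.unlock !eps_mean !mxE/= expectation.unlock => <-.
apply: eq_integral => w _.
by transitivity ((eps i w - 0) * (eps j w - 0))%R%:E; first by rewrite !subr0.
Qed.

(** The squares are integrable because the variances are finite, and they
    dominate the mixed products. *)
Lemma integrable_noiseM i j :
  P.-integrable setT (fun w => (eps i w * eps j w)%:E).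
Proof.
have mM l m : measurable_fun setT (fun w => (eps l w * eps m w)%:E).
  apply/measurable_EFinP; apply: measurable_funM; exact: measurable_funP.
have isq l : P.-integrable setT (fun w => (eps l w * eps l w)%:E).
  apply/integrableP; split => //.
  under eq_integral do rewrite abse_EFin ger0_norm -?expr2 ?sqr_ge0// expr2.
  by rewrite expectation_noiseM ltry.
apply: (le_integrable _ _ _ (integrableD _ (isq i) (isq j))) => //= w _.
rewrite lee_fin [leRHS]ger0_norm ?addr_ge0 -?expr2 ?sqr_ge0//.
move: (eps i w) (eps j w) => x y; rewrite ler_norml.
have := sqr_ge0 (x - y)%R; have := sqr_ge0 (x + y)%R.
rewrite sqrrB sqrrD => ? ?.
by apply/andP; split; lra.
Qed.

Lemma expectation_dotcv_noise_sqr (a : 'cV[R]_n) :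
  'E_P[fun w => (dotcv a (rvec eps w) ^+ 2)%R] = (s * dotcv a a)%:E.
Proof.
have -> : (fun w => (dotcv a (rvec eps w) ^+ 2)%R) = fun w =>
    (\sum_i \sum_j (a i ord0 * a j ord0) * (eps i w * eps j w))%R.
  apply/funext => w; rewrite dotcvE expr2 mulr_suml; apply: eq_bigr => i _.
  rewrite mulr_sumr; apply: eq_bigr => j _; rewrite !mxE; ring.
have integ i j : P.-integrable setT
    (fun w => ((a i ord0 * a j ord0) * (eps i w * eps j w))%:E).
  under eq_fun do rewrite EFinM.
  by apply: integrableZl => //; exact: integrable_noiseM.
rewrite unlock.
under eq_integral do rewrite -sumEFin.
under eq_integral do under eq_bigr do rewrite -sumEFin.
rewrite integral_sum//; last by move=> i; apply: integrable_sum.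
rewrite dotcvE mulr_sumr -sumEFin; apply: eq_bigr => i _.
rewrite integral_sum// (bigD1 i)//= big1 => [|j ji].
  rewrite adde0; under eq_integral do rewrite EFinM.
  rewrite integralZl//; last exact: integrable_noiseM.
  by rewrite expectation_noiseM eqxx mulr1n -EFinM; congr EFin; ring.
under eq_integral do rewrite EFinM.
rewrite integralZl//; last exact: integrable_noiseM.
by rewrite expectation_noiseM eq_sym (negbTE ji) mulr0n mule0.
Qed.

Lemma expectation_noise_norm :
  'E_P[fun w => dotcv (rvec eps w) (rvec eps w)] = (s * n%:R)%:E.
Proof.
have -> : (fun w => dotcv (rvec eps w) (rvec eps w)) =
    fun w => (\sum_i eps i w * eps i w)%R.
  by apply/funext => w; rewrite dotcvE; apply: eq_bigr => i _; rewrite !mxE.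
rewrite unlock; under eq_integral do rewrite -sumEFin.
rewrite integral_sum//; last by move=> i; exact: integrable_noiseM.
under eq_bigr do rewrite expectation_noiseM eqxx mulr1n.
by rewrite sumEFin sumr_const card_ord mulr_natr.
Qed.

Lemma measurable_dotcv_noise (a : 'cV[R]_n) :
  measurable_fun setT (fun w => dotcv a (rvec eps w)).
Proof.
under eq_fun do rewrite dotcvE.
apply: measurable_sum => i; apply: measurable_funM => //.
by under eq_fun do rewrite mxE; exact: measurable_funP.
Qed.

Lemma measurable_norm_linear_noise m (A : 'M[R]_(m, n)) :
  measurable_fun setT (fun w => dotcv (A *m rvec eps w) (A *m rvec eps w)).
Proof.
under eq_fun do rewrite dotcvvE.
apply: measurable_sum => i; apply: measurable_funX.
have -> : (fun w => (A *m rvec eps w) i ord0) =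
    fun w => dotcv (row i A)^T (rvec eps w).
  apply/funext => w; rewrite dotcvE mxE; apply: eq_bigr => j _.
  by rewrite !mxE.
exact: measurable_dotcv_noise.
Qed.

End isotropic_noise.

(** * Comparison of the mean square errors *)

Section mean_square_errors.
Context d (T : measurableType d) (R : realType) (P : probability T R).
Variables (n k : nat) (X : 'M[R]_(n, k)) (beta : 'cV[R]_k) (s : R).
Variables (eps : 'I_n -> {RV P >-> R}) (Y : T -> 'cV[R]_n).
Variables (l : R) (z : 'cV[R]_k).
Hypothesis kn : (k < n)%N.
Hypothesis s_ge0 : 0 <= s.
Hypothesis rankX : \rank X = k.
Hypothesis modelY : forall w, Y w = X *m beta + rvec eps w.
Hypothesis eps_mean : has_mean eps 0.
Hypothesis eps_cov : has_cov eps (s *: 1%:M).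
Hypothesis z_eigen : invmx (X^T *m X) *m z = l *: z.
Hypothesis z_unit : dotcv z z = 1.

Let b_mse := mean_square_error P (fun w => ols X (Y w)) beta.

(** The coefficient of z in the quasi-estimator is a sign times this number
    times the norm of the residual. *)
Let c := Num.sqrt (l / pi) *
  (Gamma ((n%:R - k%:R + 1) / 2) / Gamma ((n%:R - k%:R + 2) / 2)).

(** The squared norm of the error is at least its squared component along z. *)
Lemma mse_ols_ge : ((s * l)%:E <= b_mse)%E.
Proof.
rewrite -(dotcv_gram_eigen rankX z_eigen z_unit).
rewrite -(expectation_dotcv_noise_sqr eps_mean eps_cov).
apply: ge0_le_expectation => w; rewrite sqr_ge0/= -/(ols_error X (Y w) beta).
by rewrite modelY -(dotcv_ols_error rankX z beta) dotcv_sqr_le.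
Qed.

Lemma eigen_ge0 : 0 <= l.
Proof. by rewrite -(dotcv_gram_eigen rankX z_eigen z_unit) dotcvv_ge0. Qed.

Lemma quasi_error_le w :
  dotcv (optimal_quasi_estimator X (Y w) beta l z - beta)
    (optimal_quasi_estimator X (Y w) beta l z - beta) <=
  2 * dotcv (ols X (Y w) - beta) (ols X (Y w) - beta) +
  2 * c ^+ 2 * dotcv (rvec eps w) (rvec eps w).
Proof.
rewrite /optimal_quasi_estimator addrAC.
apply: (le_trans (dotcv_sub_le _ _)).
rewrite lerD2l// -[leRHS]mulrA ler_wpM2l//.
rewrite dotcvZl dotcvZr z_unit mulr1 -expr2 -(mulrA (sign _)) -/c.
rewrite 2!exprMn (sqr_sqrtr (dotcvv_ge0 _)).
have -> : sign (dotcv z (ols_error X (Y w) beta)) ^+ 2 = 1.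
  by rewrite /sign; case: ifP => _; rewrite ?sqrrN expr1n.
by rewrite mul1r ler_wpM2l ?sqr_ge0// modelY residual_le.
Qed.

Lemma sqr_factor_le : c ^+ 2 * n%:R <= 2 * k.+1%:R / pi * l.
Proof.
pose a : R := (n%:R - k%:R) / 2.
have nk : 1 <= n%:R - k%:R :> R.
  by rewrite lerBrDr nat1r ler_nat.
have a0 : 0 < a by rewrite divr_gt0// (lt_le_trans _ nk).
have ratio : (Gamma (a + 2^-1) / Gamma (a + 1)) ^+ 2 <= a^-1.
  rewrite -[leRHS]sqr_sqrtr ?invr_ge0 ?(ltW a0)// sqrtrV ?(ltW a0)//.
  rewrite lerXn2r ?nnegrE ?invr_ge0 ?sqrtr_ge0 ?divr_ge0 ?Gamma_ge0//.
  exact: Gamma_ratio_le.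
rewrite /c exprMn sqr_sqrtr ?divr_ge0 ?eigen_ge0 ?pi_ge0//.
rewrite (_ : (n%:R - k%:R + 1) / 2 = a + 2^-1); last by rewrite /a; field.
rewrite (_ : (n%:R - k%:R + 2) / 2 = a + 1); last by rewrite /a; field.
rewrite [leRHS](_ : _ = l / pi * (2 * k.+1%:R)); last by ring.
rewrite -[leLHS]mulrA ler_wpM2l ?divr_ge0 ?eigen_ge0 ?pi_ge0//.
apply: (le_trans (ler_wpM2r _ ratio)) => //.
rewrite [leLHS]mulrC ler_pdivrMr// /a -natr1.
(* n <= (k + 1) (n - k) is equivalent to 0 <= k (n - k - 1). *)
have km : 0 <= k%:R * (n%:R - k%:R - 1) :> R by rewrite mulr_ge0 ?subr_ge0.
by rewrite -subr_ge0 [leRHS](_ : _ = k%:R * (n%:R - k%:R - 1))//; field.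
Qed.

Lemma mse_quasi_le :
  (mean_square_error P
     (fun w => optimal_quasi_estimator X (Y w) beta l z) beta <=
   (2 + 4 * k.+1%:R / pi)%:E * b_mse)%E.
Proof.
pose M := invmx (X^T *m X) *m X^T.
have mse_ge0 : (0 <= b_mse)%E by apply: expectation_ge0 => w; exact: dotcvv_ge0.
have errE w : ols X (Y w) - beta = M *m rvec eps w.
  by rewrite modelY -(ols_error_model rankX beta).
have measb : measurable_fun setT
    (fun w => dotcv (ols X (Y w) - beta) (ols X (Y w) - beta)).
  by under eq_fun do rewrite errE; exact: measurable_norm_linear_noise.
have meas : measurable_fun setT (fun w => dotcv (rvec eps w) (rvec eps w)).
  under eq_fun do rewrite -[rvec _ _]mul1mx.
  exact: measurable_norm_linear_noise.
have c2_ge0 : 0 <= 2 * c ^+ 2 by rewrite mulr_ge0 ?sqr_ge0.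
apply: (@le_trans _ _ (2%:E * b_mse + (2 * c ^+ 2 * (s * n%:R))%:E)%E).
  rewrite EFinM -(expectation_noise_norm eps_mean eps_cov).
  rewrite /b_mse -ge0_expectation_lincomb//;
    try (by move=> w; exact: dotcvv_ge0).
  by apply: ge0_le_expectation => w; rewrite dotcvv_ge0 quasi_error_le.
rewrite [in leRHS]EFinD ge0_muleDl ?lee_fin ?divr_ge0 ?mulr_ge0 ?pi_ge0//.
rewrite leeD2l//.
apply: (@le_trans _ _ ((4 * k.+1%:R / pi)%:E * (s * l)%:E)%E); last first.
  by rewrite lee_wpmul2l ?mse_ols_ge// lee_fin divr_ge0 ?mulr_ge0 ?pi_ge0.
rewrite -EFinM lee_fin.
have := ler_wpM2l s_ge0 sqr_factor_le; lra.
Qed.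

End mean_square_errors.

Theorem proposition6 (R : realType) (k : nat) (k_ge1 : (1 <= k)%N)
    (beta : 'cV[R]_k) (sigma2 : R) (sigma2_gt0 : 0 < sigma2)
    (d : nat -> measure_display) (T : forall n : nat, measurableType (d n))
    (P : forall n : nat, probability (T n) R)
    (X : forall n : nat, 'M[R]_(n, k))
    (eps : forall n : nat, 'I_n -> {RV (P n) >-> R})
    (Y : forall n : nat, T n -> 'cV[R]_n)
    (lambda1 : nat -> R) (z1 : nat -> 'cV[R]_k)
    (rankX : forall n : nat, (k < n)%N -> \rank (X n) = k)
    (modelY : forall n : nat, (k < n)%N ->
       forall w : T n, Y n w = X n *m beta + rvec (eps n) w)
    (eps_normal : forall n : nat, (k < n)%N -> normal_rvec (eps n))
    (eps_mean : forall n : nat, (k < n)%N -> has_mean (eps n) 0)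
    (eps_cov : forall n : nat, (k < n)%N ->
       has_cov (eps n) (sigma2 *: 1%:M))
    (lambda1_max : forall n : nat, (k < n)%N ->
       is_max_eigenvalue (invmx ((X n)^T *m X n)) (lambda1 n))
    (z1_eigen : forall n : nat, (k < n)%N ->
       invmx ((X n)^T *m X n) *m z1 n = lambda1 n *: z1 n)
    (z1_unit : forall n : nat, (k < n)%N -> dotcv (z1 n) (z1 n) = 1) :
  ((fun n : nat => mean_square_error (P n)
      (fun w => ols (X n) (Y n w)) beta) @ \oo --> 0%E) ->
  ((fun n : nat => mean_square_error (P n)
      (fun w => optimal_quasi_estimator (X n) (Y n w) beta
                  (lambda1 n) (z1 n)) beta) @ \oo --> 0%E).
Proof.
move=> ols_consistent.
set C : R := 2 + 4 * k.+1%:R / pi.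
have bound_cvg : (C%:E * mean_square_error (P n)
    (fun w => ols (X n) (Y n w)) beta)%E @[n --> \oo] --> 0%E.
  by rewrite -(mule0 C%:E); exact: cvgeZl.
apply: (squeeze_cvge _ (cvg_cst 0%E) bound_cvg).
near=> n; have kn : (k < n)%N by near: n; exact: nbhs_infty_gt.
apply/andP; split; first by apply: expectation_ge0 => w; exact: dotcvv_ge0.
exact: (mse_quasi_le kn (ltW sigma2_gt0) (rankX n kn) (modelY n kn)
  (eps_mean n kn) (eps_cov n kn) (z1_eigen n kn) (z1_unit n kn)).
Unshelve. all: by end_near. Qed.
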